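(* Let $f:\mathbb{R}_+^N\to\mathbb{R}_+^N$ be a monotone and positively homogeneous map having a positive eigenvector $u$ (with positive eigenvalue), i.e. $u$ has all entries positive and $f(u)=\lambda u$ for some $\lambda>0$. Let $v^0\in\mathbb{R}_+^N$ be a vector with positive entries such that $\prod_{i=1}^N v^0_i=1$, and let $v^0,v^1,\dots$ be the sequence constructed by the projective Krasnoselskii-Mann iteration $$v^{k+1}=\left[\frac{f(v^k)}{G[f(v^k)]}\circ v^k\right]^{1/2},\qquad k\geq 0.$$ Then, for all $k\geq 1$, $$d_H(f(v^k),v^k)\leq\frac{4}{\sqrt{\pi k}}\,d_H(v^0,u).$$
   Context: $\mathbb{R}_+^N$ is the closed cone of vectors with nonnegative entries, with the entrywise order $\leq$. $f$ is monotone if $x\leq y\Rightarrow f(x)\leq f(y)$, and positively homogeneous (of degree one) if $f(\lambda x)=\lambda f(x)$ for all $\lambda>0$. $\circ$ denotes the entrywise product of vectors, $[\cdot]^{1/2}$ is the entrywise square root, and $G(x)=(x_1\cdots x_N)^{1/N}$ is the geometric mean of the entries of $x$. Hopf's oscillation (Hilbert's seminorm) on $\mathbb{R}^N$: $\|x\|_H=\inf\{\beta-\alpha:\alpha,\beta\in\mathbb{R},\ \alpha e\leq x\leq\beta e\}$ with $e=(1,\dots,1)^T$, i.e. $\|x\|_H=\max_i x_i-\min_i x_i$. Hilbert's projective metric on the interior of $\mathbb{R}_+^N$: $d_H(x,y)=\|\log x-\log y\|_H$, with $\log$ entrywise. *)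

(* Defs.v *)
From mathcomp Require Import all_boot all_order all_algebra.
From mathcomp Require Import all_classical all_reals all_analysis.

Set Implicit Arguments.
Unset Strict Implicit.
Unset Printing Implicit Defensive.

Import Order.TTheory GRing.Theory Num.Theory.

Local Open Scope classical_set_scope.
Local Open Scope ring_scope.

Definition vle (R : realType) (N : nat) (x y : 'cV[R]_N) : Prop :=
  forall i, x i 0 <= y i 0.

Definition nonneg_vec (R : realType) (N : nat) (x : 'cV[R]_N) : Prop :=
  vle 0 x.

Definition pos_vec (R : realType) (N : nat) (x : 'cV[R]_N) : Prop :=
  forall i, 0 < x i 0.

(* A self-map of the closed cone is represented by a total map on R^N; the
   three predicates below only look at its values on the cone, so its values
   elsewhere are irrelevant. *)
Definition cone_map (R : realType) (N : nat) (f : 'cV[R]_N -> 'cV[R]_N) : Prop :=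
  forall x, nonneg_vec x -> nonneg_vec (f x).

Definition cone_monotone (R : realType) (N : nat)
    (f : 'cV[R]_N -> 'cV[R]_N) : Prop :=
  forall x y, nonneg_vec x -> nonneg_vec y -> vle x y -> vle (f x) (f y).

Definition cone_homogeneous (R : realType) (N : nat)
    (f : 'cV[R]_N -> 'cV[R]_N) : Prop :=
  forall (a : R) x, 0 < a -> nonneg_vec x -> f (a *: x) = a *: f x.

Definition geo_mean (R : realType) (N : nat) (x : 'cV[R]_N) : R :=
  (\prod_i x i 0) `^ (N%:R^-1).

Definition hopf_osc (R : realType) (N : nat) (x : 'cV[R]_N) : R :=
  inf [set c : R | exists a b : R,
    [/\ vle (const_mx a) x, vle x (const_mx b) & c = b - a]].

(* Only meaningful on vectors with positive entries, since ln is 0 on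
   nonpositive reals. *)
Definition hilbert_dist (R : realType) (N : nat) (x y : 'cV[R]_N) : R :=
  hopf_osc (map_mx (@ln R) x - map_mx (@ln R) y).

Definition pkm_step (R : realType) (N : nat) (f : 'cV[R]_N -> 'cV[R]_N)
    (v : 'cV[R]_N) : 'cV[R]_N :=
  map_mx Num.sqrt (map2_mx *%R ((geo_mean (f v))^-1 *: f v) v).

(* Main.v *)
Require Import Defs.
From mathcomp Require Import all_boot all_order all_algebra.
From mathcomp Require Import all_classical all_reals all_analysis.
From mathcomp Require Import ring lra zify.

(** In logarithmic coordinates [x = ln v], [t = ln (f v / G (f v))] the
    iteration is the midpoint Krasnoselskii iteration [x' = (x + t) / 2], and
    [x |-> t] is nonexpansive for the oscillation seminorm [p].  Expanding
    one of the two points in [p (x m - x n)] and [p (x m - t n)] bounds these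
    quantities by the probability that a simple random walk on pairs of
    integers hits one line before another.  By the reflection principle this
    probability is a window of binomial weights, which at [m = n] is
    [binom (2 n + 1) n / 4 ^ n <= 2 / sqrt (pi n)] (Wallis); the remaining
    factor is a bound [2 p (x 0 - ln u)] on all the [p (x 0 - t n)]. *)

Import Order.TTheory GRing.Theory Num.Theory.
Import numFieldNormedType.Exports.

Local Open Scope ring_scope.

(** ** Wallis' bound on the central binomial coefficient *)

Section wallis.
Variable R : realType.

(* Integration by parts gives this primitive of [cos ^+ n], so that Wallis'
   integrals are the values at [pi / 2] and no integral is needed. *)
Fixpoint cosX_primitive (n : nat) (x : R) : R :=
  match n with
  | 0 => x
  | 1 => sin x
  | (m.+1 as m').+1 =>
      (cos x ^+ m' * sin x + m'%:R * cosX_primitive m x) / m'.+1%:R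
  end.

Lemma is_derive_cosX_primitive n (x : R) :
  is_derive x 1 (cosX_primitive n) (cos x ^+ n).
Proof.
elim/ltn_ind: n => -[|[|n]] IH.
- by rewrite expr0; exact: is_derive_id.
- by rewrite expr1; exact: is_derive_sin.
- have dF := IH n (leqnSn _).
  have -> : cosX_primitive n.+2 = (n.+2%:R^-1 : R) *:
    ((@cos R ^+ n.+1) * @sin R + (n.+1%:R : R) *: cosX_primitive n).
    by apply/funext => y /=; rewrite !fctE mulrC.
  have dcosX := is_deriveX n.+1 (is_derive_cos x).
  have dcosXsin := is_deriveM dcosX (is_derive_sin x).
  have dS := is_deriveD dcosXsin (is_deriveZ n.+1%:R dF).
  apply: (is_derive_eq (is_deriveZ n.+2%:R^-1 dS)).
  rewrite !fctE /GRing.scale/=.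
  have n2 : n.+2%:R != 0 :> R by rewrite pnatr_eq0.
  apply: (mulfI n2); rewrite mulVKf//.
  have := cos2Dsin2 x; set c := cos x; set s := sin x => e.
  have {e} es : s ^+ 2 = 1 - c ^+ 2 by rewrite -e; ring.
  by rewrite !exprS; ring: es.
Qed.

Lemma cosX_primitive0 n : cosX_primitive n 0 = 0.
Proof.
elim/ltn_ind: n => -[|[|n]] IH //=; first exact: sin0.
by rewrite sin0 IH// !mulr0 addr0 mul0r.
Qed.

(** The difference vanishes at 0 and has derivative [cos x ^+ n * (1 - cos x)], nonnegative between
    0 and [pi / 2]. *)
Lemma cosX_primitive_pihalf_le n :
  cosX_primitive n.+1 (pi / 2) <= cosX_primitive n (pi / 2).
Proof.
pose G := cosX_primitive n - cosX_primitive n.+1.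
have dG (x : R) : is_derive x 1 G (cos x ^+ n - cos x ^+ n.+1).
  by apply: is_deriveB; exact: is_derive_cosX_primitive.
suff : G 0 <= G (pi / 2).
  by rewrite /G !fctE !cosX_primitive0 subrr subr_ge0.
apply: (@ger0_derive1_ndecr _ G 0 (pi / 2)) => //.
- move=> x; rewrite in_itv/= => /andP[x0 xp].
  rewrite derive1E (@derive_val _ _ _ _ _ _ _ (dG x)) subr_ge0 exprS.
  have c0 : 0 <= cos x.
    apply: cos_ge0_pihalf; rewrite (ltW xp) andbT (le_trans _ (ltW x0))//.
    by rewrite oppr_le0 divr_ge0// pi_ge0.
  by rewrite ler_piMl ?exprn_ge0 ?cos_le1.
- apply: continuous_subspaceT => x.
  by apply/differentiable_continuous/derivable1_diffP.
- by rewrite divr_ge0 ?pi_ge0.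
Qed.

(** The probability of exactly [n] heads in [2 n] tosses of a fair coin. *)
Definition central_prob (n : nat) : R := 'C(n.*2, n)%:R / 4 ^+ n.

Lemma central_prob_gt0 n : 0 < central_prob n.
Proof. by rewrite divr_gt0 ?exprn_gt0// ltr0n bin_gt0 -addnn leq_addr. Qed.

Lemma central_probS n :
  central_prob n.+1 = n.*2.+1%:R / n.*2.+2%:R * central_prob n.
Proof.
rewrite /central_prob doubleS.
(* The central entries of rows [2 n] and [2 n + 2] are linked through ['C(n.*2.+1, n)]. *)
have h : (n.+1 * 'C(n.*2.+2, n.+1) = n.*2.+1.*2 * 'C(n.*2, n))%N.
  have := mul_bin_diag n.*2.+2 n; have := mul_bin_left n.*2.+1 n.
  have := mul_bin_down n.*2.+1 n; rewrite /=.
  have -> : (n.*2.+1 - n = n.+1)%N by lia.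
  nia.
have {}h : n.+1%:R * 'C(n.*2.+2, n.+1)%:R = 2 * n.*2.+1%:R * 'C(n.*2, n)%:R :> R.
  by rewrite -!natrM h -muln2; congr _%:R; lia.
have n1 : n.+1%:R != 0 :> R by rewrite pnatr_eq0.
have h4 : 4 ^+ n != 0 :> R by rewrite expf_neq0// pnatr_eq0.
have -> : n.*2.+2%:R = 2 * n.+1%:R :> R by rewrite -natrM mul2n.
apply: (mulfI n1); rewrite [LHS]mulrA h exprS; field.
by rewrite h4 nat1r n1.
Qed.

Lemma cosX_primitive_pihalfSS n : cosX_primitive n.+2 (pi / 2) =
  n.+1%:R / n.+2%:R * cosX_primitive n (pi / 2).
Proof. by rewrite /= cos_pihalf expr0n mul0r add0r mulrAC. Qed.

Lemma cosX_primitive_pihalf n :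
  cosX_primitive n.*2 (pi / 2) = pi / 2 * central_prob n /\
  cosX_primitive n.*2.+1 (pi / 2) = (n.*2.+1%:R * central_prob n)^-1.
Proof.
elim: n => [|n [IH0 IH1]].
  by rewrite /central_prob/= sin_pihalf bin0 expr0 divr1 !mulr1 invr1.
rewrite doubleS !cosX_primitive_pihalfSS IH0 IH1 central_probS.
have n3 : n.*2.+3%:R != 0 :> R by rewrite pnatr_eq0.
have n2 : n.*2.+2%:R != 0 :> R by rewrite pnatr_eq0.
have n1 : n.*2.+1%:R != 0 :> R by rewrite pnatr_eq0.
have w := lt0r_neq0 (central_prob_gt0 n).
move: n1 n2 n3 w; move: n.*2.+1%:R n.*2.+2%:R n.*2.+3%:R (central_prob n).
move=> a b c w a0 b0 c0 w0; split; field => //.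
by rewrite w0 c0 b0 a0.
Qed.

(** With [w = central_prob n.+1], the Wallis values of orders [2 n + 2] and [2 n + 1] are
    [pi / 2 * w] and [1 / (2 (n + 1) w)]; their order says [pi * (n + 1) * w ^+ 2 <= 1]. *)
Lemma central_prob_le n : central_prob n.+1 <= (Num.sqrt (pi * n.+1%:R))^-1.
Proof.
have p0 : 0 < pi :> R by exact: pi_gt0.
have w0 := central_prob_gt0 n; have w1 := central_prob_gt0 n.+1.
rewrite -sqrtrV ?mulr_ge0 ?(ltW p0)// -(ger0_norm (ltW w1)) -sqrtr_sqr.
rewrite ler_wsqrtr//.
have := cosX_primitive_pihalf_le n.*2.+1.
rewrite -doubleS (cosX_primitive_pihalf n.+1).1 (cosX_primitive_pihalf n).2.
have -> : n.*2.+1%:R * central_prob n = 2 * n.+1%:R * central_prob n.+1.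
  rewrite central_probS -natrM mul2n doubleS [RHS]mulrA.
  by rewrite (mulrC n.*2.+2%:R) divfK// pnatr_eq0.
have n0 : 0 < n.+1%:R :> R by rewrite ltr0n.
move: (central_prob n.+1) n.+1%:R w1 n0 => w m w1 n0.
rewrite -[leRHS]mul1r ler_pdivlMr ?mulr_gt0// => H.
rewrite -[leRHS]mul1r ler_pdivlMr ?mulr_gt0//.
by rewrite (le_trans _ H)// le_eqVlt; apply/orP; left; apply/eqP; field.
Qed.

End wallis.

(** ** Absorption probabilities of the random walk *)

Section binom_window.
Variable R : realFieldType.

(* For [0 < m <= n.+1], the probability that a walk starting at [(m, n)] and
   decreasing one of its coordinates, chosen by a fair coin, reaches [m = 0]
   before [m = n + 1]. *)
Definition binom_window (m n : nat) : R :=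
  (\sum_(m <= k < n.+1) 'C(m + n, k))%:R / 2 ^+ (m + n).

(** This and the next lemma are the boundary values on the two absorbing lines. *)
Lemma binom_window0 n : binom_window 0 n = 1.
Proof.
rewrite /binom_window add0n big_mkord.
have -> : (\sum_(i < n.+1) 'C(n, i) = 2 ^ n)%N.
  rewrite -[2%N]/(1 + 1)%N expnDn.
  by apply: eq_bigr => i _; rewrite !exp1n !muln1.
by rewrite natrX divff// expf_neq0// pnatr_eq0.
Qed.

Lemma binom_window_diag n : binom_window n.+1 n = 0.
Proof. by rewrite /binom_window big_geq// mul0r. Qed.

(** First-step analysis of the walk. Pascal's rule gives two windows of equal length in row
    [m + n + 1]; moving the term [k = m] from one to the other yields those of the two successor
    states. *)
Lemma binom_window_rec m n : (m <= n)%N ->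
  binom_window m.+1 n.+1 = (binom_window m n.+1 + binom_window m.+1 n) / 2.
Proof.
move=> mn; rewrite /binom_window.
have -> : (\sum_(m.+1 <= k < n.+2) 'C(m.+1 + n.+1, k) =
  \sum_(m <= k < n.+2) 'C(m + n.+1, k) +
  \sum_(m.+1 <= k < n.+1) 'C(m.+1 + n, k))%N.
  have -> : (\sum_(m.+1 <= k < n.+2) 'C(m.+1 + n.+1, k) =
      \sum_(m.+1 <= k < n.+2) 'C(m + n.+1, k) +
      \sum_(m <= k < n.+1) 'C(m + n.+1, k))%N.
    by rewrite !big_add1 -big_split/=; apply: eq_bigr => k _; rewrite addSn binS.
  rewrite (@big_ltn _ _ _ m n.+1)// (@big_ltn _ _ _ m n.+2)//; last exact: ltnW.
  by rewrite addSnnS addnCA addnA.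
rewrite natrD !addSn !addnS exprS.
set a : R := _%:R; set b : R := _%:R.
have h : 2 ^+ (m + n) != 0 :> R by rewrite expf_neq0// pnatr_eq0.
by rewrite exprS; field.
Qed.

End binom_window.

(** ** The midpoint Krasnoselskii iteration for a seminorm *)

Section krasnoselskii.
Variable R : realFieldType.
Variables (V : lmodType R) (p : V -> R) (x t : nat -> V) (q : V).
Hypothesis pD : forall a b, p (a + b) <= p a + p b.
Hypothesis pZ : forall (c : R) a, 0 <= c -> p (c *: a) = c * p a.
Hypothesis xS : forall n, x n.+1 = 2^-1 *: (x n + t n).
Hypothesis t_nonexp : forall m n, p (t m - t n) <= p (x m - x n).
Hypothesis qt_le : forall n, p (q - t n) <= p (q - x n).

Lemma midpointB a b c : 2^-1 *: (a + b) - c = 2^-1 *: ((a - c) + (b - c)) :> V.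
Proof.
rewrite addrACA -opprD -mulr2n scalerBr -(scaler_nat 2 c) scalerA mulVf.
  by rewrite scale1r.
by rewrite pnatr_eq0.
Qed.

Lemma midpoint_le a b c : p (2^-1 *: (a + b) - c) <= (p (a - c) + p (b - c)) / 2.
Proof. by rewrite midpointB pZ ?invr_ge0// mulrC ler_pM2r ?invr_gt0. Qed.

Lemma le_midpoint a b c : p (c - 2^-1 *: (a + b)) <= (p (c - a) + p (c - b)) / 2.
Proof.
rewrite -opprB midpointB -scalerN opprD !opprB.
by rewrite pZ ?invr_ge0// mulrC ler_pM2r ?invr_gt0.
Qed.

(** By [qt_le], [q] acts as a fixed point: [p (q - x n)] never increases, so the detour through [q]
    is controlled by the starting point. *)
Lemma start_image_le n : p (x 0%N - t n) <= p (x 0%N - q) + p (q - x 0%N).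
Proof.
have -> : x 0%N - t n = (x 0%N - q) + (q - t n) by rewrite addrA subrK.
rewrite (le_trans (pD _ _))// lerD2l (le_trans (qt_le _))//.
elim: n => // n IH; rewrite xS (le_trans (le_midpoint _ _ _))//.
have := qt_le n; lra.
Qed.

(** Here [p (x m - t k)] corresponds to the state [(m, k.+1)] and [p (x m - x l)] to [(m.+1, l)].
    Expanding a midpoint is one step of the walk, and [t_nonexp] replaces [t m - t k] by
    [x m - x k]. *)
Lemma krasnoselskii_bound n : p (x n - t n) <=
  (p (x 0%N - q) + p (q - x 0%N)) * binom_window R n n.+1.
Proof.
set D := p (x 0%N - q) + p (q - x 0%N).
(* The two bounds feed each other: the one on [p (x m - t k)] for all [k]
   gives [xx], by induction on [l], and both then give the case [m.+1]. *)
suff H m : forall k, (m <= k)%N -> p (x m - t k) <= D * binom_window R m k.+1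
  by exact: H.
elim: m => [k _|m IH k mk]; first by rewrite binom_window0 mulr1 start_image_le.
have xx l : (m <= l)%N -> p (x m - x l) <= D * binom_window R m.+1 l.
  move=> /subnKC <-; elim: (l - m)%N => [|j IHj].
    (* At [l = m] the walk is absorbed with value 0, and [p 0 = 0] by homogeneity with factor 0. *)
    rewrite addn0 binom_window_diag mulr0 subrr -(scale0r 0) pZ//.
    by rewrite mul0r.
  rewrite addnS xS binom_window_rec ?leq_addr// (le_trans (le_midpoint _ _ _))//.
  have := IH (m + j)%N (leq_addr _ _); lra.
rewrite xS binom_window_rec ?(ltnW mk)// (le_trans (midpoint_le _ _ _))//.
have := IH k (ltnW mk); have := xx k (ltnW mk); have := t_nonexp m k; lra.
Qed.

End krasnoselskii.

(** The window consists of the two middle entries of row [2 n + 1], equal by symmetry and each at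
    most [2 * 'C(n.*2, n)]. *)
Lemma binom_window_near_diag (R : realType) n : (0 < n)%N ->
  binom_window R n n.+1 <= 2 / Num.sqrt (pi * n%:R).
Proof.
case: n => // n _; apply: (@le_trans _ _ (2 * central_prob R n.+1)); last first.
  by rewrite ler_pM2l// central_prob_le.
rewrite /binom_window /central_prob; move: n.+1 => {}n.
rewrite big_nat_recr ?leqnSn//= big_nat1 addnS addnn.
have -> : 'C(n.*2.+1, n) = 'C(n.*2.+1, n.+1).
  by rewrite -bin_sub; [congr 'C(_, _); lia|lia].
rewrite addnn exprS -muln2 natrM -mul2n exprM -natrX.
have h : ('C(n.*2.+1, n.+1) <= 2 * 'C(n.*2, n))%N.
  by have := mul_bin_diag n.*2.+1 n; rewrite /=; nia.
have h4 : 0 < 4 ^+ n :> R by rewrite exprn_gt0.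
rewrite -mul2n -(ler_nat R) natrM in h.
by rewrite invfM mulrA mulfK ?pnatr_eq0// mulrA ler_pM2r ?invr_gt0.
Qed.

(** ** Hilbert's metric and the projective iteration *)

Section hopf.
Variables (R : realType) (N : nat).
Hypothesis hN : (0 < N)%N.
Implicit Types x y : 'cV[R]_N.

(** The infimum is attained at the least and greatest entries; the seminorm properties below follow
    by selecting such a pair of indices. *)
Lemma hopf_osc_max_min x : exists i j, hopf_osc x = x i 0 - x j 0 /\
  forall k, x j 0 <= x k 0 <= x i 0.
Proof.
case: (@arg_maxP _ _ _ (Ordinal hN) predT (fun i => x i 0)) => // i _ iP.
case: (@arg_minP _ _ _ (Ordinal hN) predT (fun i => x i 0)) => // j _ jP.
have {}iP k : x k 0 <= x i 0 by exact: iP.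
have {}jP k : x j 0 <= x k 0 by exact: jP.
exists i, j; split; last by move=> k; rewrite jP iP.
rewrite /hopf_osc; set E := (E in inf E).
have lE : lbound E (x i 0 - x j 0).
  move=> _ [a [b [ax xb ->]]].
  by have := ax j; have := xb i; rewrite !mxE; lra.
have Ex : E (x i 0 - x j 0).
  by exists (x j 0), (x i 0); split => // k; rewrite mxE ?jP ?iP.
apply/eqP; rewrite eq_le lb_le_inf//; last by exists (x i 0 - x j 0).
by rewrite ge_inf//; exists (x i 0 - x j 0).
Qed.

Lemma hopf_osc_ge x i j : x i 0 - x j 0 <= hopf_osc x.
Proof.
have [k [l [-> H]]] := hopf_osc_max_min x.
have /andP[_ ?] := H i; have /andP[? _] := H j; lra.
Qed.

Lemma hopf_oscD x y : hopf_osc (x + y) <= hopf_osc x + hopf_osc y.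
Proof.
have [i [j [-> _]]] := hopf_osc_max_min (x + y).
by have := hopf_osc_ge x i j; have := hopf_osc_ge y i j; rewrite !mxE; lra.
Qed.

Lemma hopf_oscZ_le (c : R) x : 0 <= c -> hopf_osc (c *: x) <= c * hopf_osc x.
Proof.
move=> c0; have [i [j [-> _]]] := hopf_osc_max_min (c *: x).
by rewrite !mxE -mulrBr ler_wpM2l// hopf_osc_ge.
Qed.

Lemma hopf_oscZ (c : R) x : 0 <= c -> hopf_osc (c *: x) = c * hopf_osc x.
Proof.
move=> c0; apply/eqP; rewrite eq_le hopf_oscZ_le//=.
have [i [j [-> _]]] := hopf_osc_max_min x.
by rewrite mulrBr; have := hopf_osc_ge (c *: x) i j; rewrite !mxE.
Qed.

Lemma hopf_oscN x : hopf_osc (- x) = hopf_osc x.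
Proof.
apply/eqP; rewrite eq_le; apply/andP; split.
  have [i [j [-> _]]] := hopf_osc_max_min (- x).
  by have := hopf_osc_ge x j i; rewrite !mxE; lra.
have [i [j [-> _]]] := hopf_osc_max_min x.
by have := hopf_osc_ge (- x) j i; rewrite !mxE; lra.
Qed.

(** In logarithmic coordinates this discards scalar factors: the normalisation by [geo_mean] and the
    eigenvalue. *)
Lemma hopf_osc_addc x (c : R) : hopf_osc (x + const_mx c) = hopf_osc x.
Proof.
apply/eqP; rewrite eq_le; apply/andP; split.
  have [i [j [-> _]]] := hopf_osc_max_min (x + const_mx c).
  by have := hopf_osc_ge x i j; rewrite !mxE; lra.
have [i [j [-> _]]] := hopf_osc_max_min x.
by have := hopf_osc_ge (x + const_mx c) i j; rewrite !mxE; lra.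
Qed.

Lemma ln_sub_le (a b c : R) : 0 < a -> 0 < b ->
  (ln a - ln b <= c) = (a <= expR c * b).
Proof.
move=> a0 b0; rewrite lerBlDr -[in LHS](expRK c) -lnM ?posrE ?expR_gt0//.
by rewrite ler_ln ?posrE ?mulr_gt0 ?expR_gt0.
Qed.

Lemma pos_nonneg x : pos_vec x -> nonneg_vec x.
Proof. by move=> px i; rewrite mxE ltW. Qed.

Lemma pos_vecZ (c : R) x : 0 < c -> pos_vec x -> pos_vec (c *: x).
Proof. by move=> c0 px i; rewrite mxE mulr_gt0. Qed.

Lemma geo_mean_gt0 x : pos_vec x -> 0 < geo_mean x.
Proof. by move=> px; apply/powR_gt0/prodr_gt0 => i _; exact: px. Qed.

(** * Monotone homogeneous maps in Hilbert's metric *)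

Variable f : 'cV[R]_N -> 'cV[R]_N.
Hypothesis f_mono : cone_monotone f.
Hypothesis f_homo : cone_homogeneous f.

(** The bound means [x <= expR c * y] entrywise, an inequality that monotonicity and homogeneity
    carry over to the images. *)
Lemma ln_cone_map_le x y (c : R) :
  pos_vec x -> pos_vec y -> pos_vec (f x) -> pos_vec (f y) ->
  (forall i, ln (x i 0) - ln (y i 0) <= c) ->
  forall i, ln (f x i 0) - ln (f y i 0) <= c.
Proof.
move=> px py pfx pfy xy i; rewrite ln_sub_le//.
have : vle x (expR c *: y) by move=> k; rewrite mxE -ln_sub_le.
have pcy := pos_vecZ _ _ (expR_gt0 c) py.
move=> /(f_mono _ _ (pos_nonneg _ px) (pos_nonneg _ pcy)) /(_ i).
by rewrite f_homo ?mxE//; [exact: expR_gt0|exact: pos_nonneg].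
Qed.

Lemma hilbert_dist_nonexpansive x y :
  pos_vec x -> pos_vec y -> pos_vec (f x) -> pos_vec (f y) ->
  hilbert_dist (f x) (f y) <= hilbert_dist x y.
Proof.
move=> px py pfx pfy; rewrite /hilbert_dist.
have [i [j [-> _]]] := hopf_osc_max_min (map_mx (@ln R) (f x) - map_mx (@ln R) (f y)).
have [k [l [-> H]]] := hopf_osc_max_min (map_mx (@ln R) x - map_mx (@ln R) y).
(* One use bounds the maximum of the log-ratio; the other, with [x] and [y] exchanged, bounds its
   minimum. *)
have Hi := ln_cone_map_le _ _ _ px py pfx pfy _ i.
have Hj := ln_cone_map_le _ _ _ py px pfy pfx _ j.
have {}/Hi Hi m : ln (x m 0) - ln (y m 0) <= ln (x k 0) - ln (y k 0).
  by have /andP[_] := H m; rewrite !mxE.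
have {}/Hj Hj m : ln (y m 0) - ln (x m 0) <= ln (y l 0) - ln (x l 0).
  by have /andP[+ _] := H m; rewrite !mxE; lra.
by move: Hi Hj; rewrite !mxE; lra.
Qed.

(** With [a] the least entry of [ln x - ln u], the vector [x] dominates [expR a *: u], so [f x]
    dominates a positive multiple of [u]. *)
Lemma cone_map_pos (u : 'cV[R]_N) (lambda : R) : pos_vec u -> 0 < lambda ->
  f u = lambda *: u -> forall x, pos_vec x -> pos_vec (f x).
Proof.
move=> pu l0 fu x px i.
have [i0 [j [_ H]]] := hopf_osc_max_min (map_mx (@ln R) x - map_mx (@ln R) u).
pose a := ln (x j 0) - ln (u j 0).
have pau := pos_vecZ _ _ (expR_gt0 a) pu.
have : vle (expR a *: u) x.
  move=> k; have /andP[+ _] := H k; rewrite !mxE -/a => ak.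
  have : ln (u k 0) - ln (x k 0) <= - a by lra.
  by rewrite ln_sub_le// expRN mulrC ler_pdivlMr ?expR_gt0// mulrC.
move=> /(f_mono _ _ (pos_nonneg _ pau) (pos_nonneg _ px)) /(_ i); apply: lt_le_trans.
rewrite f_homo ?expR_gt0//; last exact: pos_nonneg.
by rewrite fu; apply: pos_vecZ; [exact: expR_gt0|exact: pos_vecZ].
Qed.

Lemma ln_pkm_step x : pos_vec x -> pos_vec (f x) ->
  map_mx (@ln R) (pkm_step f x) = 2^-1 *: (map_mx (@ln R) x +
    (map_mx (@ln R) (f x) - const_mx (ln (geo_mean (f x))))).
Proof.
move=> px pfx; apply/colP => i; rewrite !mxE.
have G0 : 0 < (geo_mean (f x))^-1 by rewrite invr_gt0 geo_mean_gt0.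
have fxi := pfx i; have xi := px i.
rewrite -powR12_sqrt ?mulr_ge0 ?ltW// ln_powR !lnM ?lnV ?posrE ?mulr_gt0//.
  by rewrite addrC [- _ + _]addrC.
exact: geo_mean_gt0.
Qed.

Lemma pkm_step_pos x : pos_vec x -> pos_vec (f x) -> pos_vec (pkm_step f x).
Proof.
move=> px pfx i; rewrite !mxE sqrtr_gt0 !mulr_gt0// invr_gt0.
exact: geo_mean_gt0.
Qed.

End hopf.

Theorem corollary12 (R : realType) (N : nat) (hN : (0 < N)%N)
    (f : 'cV[R]_N -> 'cV[R]_N)
    (f_cone : cone_map f)
    (f_mono : cone_monotone f)
    (f_homo : cone_homogeneous f)
    (u : 'cV[R]_N) (lambda : R)
    (u_pos : pos_vec u) (lambda_pos : 0 < lambda)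
    (u_eigen : f u = lambda *: u)
    (v : nat -> 'cV[R]_N)
    (v0_pos : pos_vec (v 0%N))
    (v0_prod : \prod_(i < N) v 0%N i 0 = 1)
    (v_iter : forall k : nat, v k.+1 = pkm_step f (v k)) :
  forall k : nat, (1 <= k)%N ->
    hilbert_dist (f (v k)) (v k)
      <= 4 / Num.sqrt (pi * k%:R) * hilbert_dist (v 0%N) u.
Proof.
move=> k k1.
have fpos := cone_map_pos _ _ hN f f_mono f_homo u lambda u_pos lambda_pos u_eigen.
have vpos n : pos_vec (v n).
  by elim: n => // n IH; rewrite v_iter; apply: pkm_step_pos => //; exact: fpos.
pose x n := map_mx (@ln R) (v n); pose q := map_mx (@ln R) u.
pose t n := map_mx (@ln R) (f (v n)) - const_mx (ln (geo_mean (f (v n)))).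
have xS n : x n.+1 = 2^-1 *: (x n + t n).
  by rewrite /x v_iter ln_pkm_step//; exact: fpos.
(* The eigenvector is fixed up to a constant vector, which the seminorm ignores. *)
have lnfu : map_mx (@ln R) (f u) = q + const_mx (ln lambda).
  by apply/colP => i; rewrite u_eigen !mxE lnM ?posrE// addrC.
have tt m n : hopf_osc (t m - t n) <= hopf_osc (x m - x n).
  have -> : t m - t n = map_mx (@ln R) (f (v m)) - map_mx (@ln R) (f (v n)) +
      const_mx (ln (geo_mean (f (v n))) - ln (geo_mean (f (v m)))).
    by apply/colP => i; rewrite !mxE; ring.
  by rewrite hopf_osc_addc//; apply: hilbert_dist_nonexpansive => //; exact: fpos.
have tq n : hopf_osc (t n - q) <= hopf_osc (x n - q).
  have -> : t n - q = map_mx (@ln R) (f (v n)) - map_mx (@ln R) (f u) +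
      const_mx (ln lambda - ln (geo_mean (f (v n)))).
    by rewrite lnfu; apply/colP => i; rewrite !mxE; ring.
  by rewrite hopf_osc_addc//; apply: hilbert_dist_nonexpansive => //; exact: fpos.
have qt n : hopf_osc (q - t n) <= hopf_osc (q - x n).
  by rewrite -opprB hopf_oscN// -[leRHS]hopf_oscN// opprB; exact: tq.
have := @krasnoselskii_bound R _ (@hopf_osc R N) x t q
  (hopf_oscD _ _ hN) (hopf_oscZ _ _ hN) xS tt qt k.
have -> : x k - t k = - (map_mx (@ln R) (f (v k)) - x k) +
    const_mx (ln (geo_mean (f (v k)))).
  by apply/colP => i; rewrite !mxE; ring.
rewrite hopf_osc_addc// hopf_oscN// -(hopf_oscN _ _ hN (q - _)) opprB => H.
apply: (le_trans H).
(* The constant 4 is a factor 2 from the two distances to [q] times the 2 of the window estimate. *)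
have -> : 4 / Num.sqrt (pi * k%:R) * hilbert_dist (v 0%N) u =
    (hilbert_dist (v 0%N) u + hilbert_dist (v 0%N) u) * (2 / Num.sqrt (pi * k%:R)).
  by ring.
rewrite ler_wpM2l ?binom_window_near_diag//.
have d0 : 0 <= hilbert_dist (v 0%N) u.
  by have := hopf_osc_ge _ _ hN (x 0%N - q) (Ordinal hN) (Ordinal hN); rewrite subrr.
exact: addr_ge0.
Qed.
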